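(* Let $[S]=\{[f]_1,\ldots,[f]_\ell\}\subset[\mathbb{R}][x_1,\ldots,x_n]$ be a finite system of interval polynomials and let $\prec$ be a monomial ordering on $\mathbb{R}[x_1,\ldots,x_n]$. Then the set of initial ideals $$\{\,in(I)\ :\ I\in\mathcal{IF}([S])\,\}$$ is finite.
   Context: A real interval is a set of one of the forms $[a,b]$, $(a,b]$, $[a,b)$, $(a,b)$ with $a,b\in\mathbb{R}\cup\{\pm\infty\}$ (closed endpoints finite). An interval polynomial is a formal expression $[f]=\sum_{i=1}^m I_i\,x^{\alpha_i}$ where each $I_i$ is a real interval and the $x^{\alpha_i}$ are monomials in $x_1,\dots,x_n$; $[\mathbb{R}][x_1,\ldots,x_n]$ denotes the set of interval polynomials. The family of $[f]$ is $\mathcal{F}([f])=\{\sum_{i=1}^m c_i x^{\alpha_i}: c_i\in I_i\}\subset\mathbb{R}[x_1,\dots,x_n]$, and for $[S]=\{[f]_1,\ldots,[f]_\ell\}$, $\mathcal{F}([S])=\mathcal{F}([f]_1)\times\cdots\times\mathcal{F}([f]_\ell)$. The ideal family is $\mathcal{IF}([S])=\{\langle p_1,\ldots,p_\ell\rangle : (p_1,\ldots,p_\ell)\in\mathcal{F}([S])\}$. For an ideal $I\subseteq\mathbb{R}[x_1,\dots,x_n]$, $in(I)$ is the ideal generated by the leading monomials (w.r.t. $\prec$) of the nonzero elements of $I$. *)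

(* Defs.v *)
From Stdlib Require Import Reals.
From Stdlib Require List.
From mathcomp Require Import all_boot.

Set Implicit Arguments.
Unset Strict Implicit.
Unset Printing Implicit Defensive.

(* Monomials in x_1..x_n : exponent vectors. *)
Definition Mon (n : nat) := n.-tuple nat.

Definition mmul (n : nat) (a b : Mon n) : Mon n :=
  [tuple addn (tnth a i) (tnth b i) | i < n].

(* A real polynomial, represented as a finite list of terms (c, x^a);
   its value as a polynomial is given by its coefficient function. *)
Definition rpoly (n : nat) := seq (R * Mon n)%type.

Definition coef (n : nat) (p : rpoly n) (m : Mon n) : R :=
  foldr (fun (t : (R * Mon n)%type) (acc : R) => Rplus (if t.2 == m then t.1 else R0) acc) R0 p.

Definition pmul (n : nat) (p q : rpoly n) : rpoly n :=
  flatten [seq [seq (Rmult t.1 u.1, mmul t.2 u.2) | u <- q] | t <- p].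

Definition mono (n : nat) (a : Mon n) : rpoly n := [:: (R1, a)].

Definition in_gen_ideal (n : nat) (gs : seq (rpoly n)) (q : rpoly n) : Prop :=
  exists hs : seq (rpoly n), size hs = size gs /\
    forall m, coef q m = coef (flatten [seq pmul hg.1 hg.2 | hg <- zip hs gs]) m.

Record monomial_order (n : nat) (lt : Mon n -> Mon n -> Prop) : Prop := {
  mo_irrefl : forall a, ~ lt a a;
  mo_trans  : forall a b c, lt a b -> lt b c -> lt a c;
  mo_total  : forall a b, a = b \/ lt a b \/ lt b a;
  mo_mul    : forall a b c, lt a b -> lt (mmul a c) (mmul b c);
  mo_wf     : well_founded lt }.

Definition leading_mon (n : nat) (lt : Mon n -> Mon n -> Prop)
    (f : rpoly n) (a : Mon n) : Prop :=
  coef f a <> R0 /\ forall b, coef f b <> R0 -> b = a \/ lt b a.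

Definition initial_ideal (n : nat) (lt : Mon n -> Mon n -> Prop)
    (I : rpoly n -> Prop) (q : rpoly n) : Prop :=
  exists gs : seq (Mon n),
    (forall a, List.In a gs -> exists f, I f /\ leading_mon lt f a) /\
    in_gen_ideal [seq mono a | a <- gs] q.

(* Real intervals: a lower and an upper end; None = -oo (resp. +oo),
   Some (true, a) = closed end a, Some (false, a) = open end a. *)
Record interval := Interval { ilo : option (bool * R); ihi : option (bool * R) }.

Definition in_interval (x : R) (I : interval) : Prop :=
  match ilo I with
  | None => True
  | Some (cl, a) => if cl then Rle a x else Rlt a x
  end /\
  match ihi I with
  | None => True
  | Some (cl, b) => if cl then Rle x b else Rlt x b
  end.

Definition ipoly (n : nat) := seq (interval * Mon n)%type.

Definition in_family (n : nat) (f : ipoly n) (p : rpoly n) : Prop :=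
  exists cs : seq R,
    List.Forall2 (fun c t => in_interval c t.1) cs f /\
    forall m, coef p m = coef (zip cs [seq t.2 | t <- f]) m.

Definition in_system_family (n : nat) (S : seq (ipoly n)) (ps : seq (rpoly n)) : Prop :=
  List.Forall2 (fun f p => in_family f p) S ps.

(* Main.v *)
Require Import Defs.
From Stdlib Require Import Reals Lra Classical ClassicalEpsilon.
From Stdlib Require List.
From mathcomp Require Import all_boot.

(** Only the supports of the generators matter, not the intervals. Run
    Buchberger's algorithm on all systems with supports in a fixed finite set at
    once: given the list [s] of leading monomials and a finite set [T]
    containing the supports of the current basis, the S-polynomials and their
    reductions have supports in a finite set [T'] computed from [s] and [T]
    alone. So either all S-polynomials reduce to zero, and the initial ideal is
    generated by [s], or the basis is enlarged by a remainder whose leading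
    monomial is one of finitely many candidates outside the monomial ideal of
    [s]. The resulting tree is finitely branching, and well-founded by
    Dickson's lemma. *)

Set Implicit Arguments.
Unset Strict Implicit.
Unset Printing Implicit Defensive.

(** * Monomials and divisibility *)

Section Monomials.

Context {n : nat}.
Implicit Types a b c m u v w : Mon n.

Lemma mmulC a b : mmul a b = mmul b a.
Proof. by apply: eq_from_tnth => i; rewrite !tnth_mktuple addnC. Qed.

Lemma mmulA a b c : mmul a (mmul b c) = mmul (mmul a b) c.
Proof. by apply: eq_from_tnth => i; rewrite !tnth_mktuple addnA. Qed.

Lemma mmulI a b c : mmul a b = mmul a c -> b = c.
Proof.
move=> e; apply: eq_from_tnth => i.
move/(congr1 (fun t => tnth t i)): e.
by rewrite !tnth_mktuple => /addnI.
Qed.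

Definition mdvd a m : Prop := exists u, m = mmul u a.

(** The subtraction is truncated, so this is a quotient only when [u] divides [m]; multiplying back
    by [u] tests that. *)
Definition mdiv m u : Mon n := [tuple tnth m i - tnth u i | i < n].

Lemma mmulK u m : mdiv (mmul u m) u = m.
Proof. by apply: eq_from_tnth => i; rewrite !tnth_mktuple addKn. Qed.

Lemma mdvd_tnth a m : (forall i, tnth a i <= tnth m i) -> mdvd a m.
Proof.
move=> le_am; exists (mdiv m a); apply: eq_from_tnth => i.
by rewrite !tnth_mktuple subnK.
Qed.

Lemma mdvd_leq a m : mdvd a m -> forall i, tnth a i <= tnth m i.
Proof. by case=> u -> i; rewrite tnth_mktuple leq_addl. Qed.

Lemma mdvd_lcm a b : exists m u v, [/\ m = mmul u a, m = mmul v b &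
  forall k, mdvd a k -> mdvd b k -> mdvd m k].
Proof.
pose m : Mon n := [tuple maxn (tnth a i) (tnth b i) | i < n].
have [u mu] : mdvd a m.
  by apply: mdvd_tnth => i; rewrite tnth_mktuple leq_maxl.
have [v mv] : mdvd b m.
  by apply: mdvd_tnth => i; rewrite tnth_mktuple leq_maxr.
exists m, u, v; split=> // k /mdvd_leq le_ak /mdvd_leq le_bk.
by apply: mdvd_tnth => i; rewrite tnth_mktuple geq_max le_ak le_bk.
Qed.

End Monomials.

(** * Dickson's lemma *)

(** As long as a later value is smaller, move there; this descent in the natural numbers stops. *)
Lemma exists_suffix_min (g : nat -> nat) N :
  exists i, N <= i /\ forall j, i <= j -> g i <= g j.
Proof.
have [k] := ubnP (g N); elim: k N => // k IH N le_gN.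
case: (classic (exists j, N <= j /\ g j < g N)) => [[j [leNj lt_g]]|no].
  have [i [le_ji min_i]] := IH j (leq_trans lt_g le_gN).
  by exists i; split=> //; apply: leq_trans le_ji.
exists N; split=> // j leNj; rewrite leqNgt; apply/negP => lt_g.
by apply: no; exists j.
Qed.

Lemma nondecreasing_subseq (g : nat -> nat) :
  exists phi : nat -> nat, {homo phi : i j / i < j} /\
    {homo g \o phi : i j / i <= j}.
Proof.
pose h N := proj1_sig (constructive_indefinite_description _
  (exists_suffix_min g N)).
have hP N : N <= h N /\ forall j, h N <= j -> g (h N) <= g j.
  by rewrite /h; case: constructive_indefinite_description.
(* Searching again strictly after the previous index makes [phi] increasing, and each [phi k] is a
   suffix minimum of [g]. *)
pose phi := fix phi k := if k is k'.+1 then h (phi k').+1 else h 0.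
have phiS k : phi k < phi k.+1 by case: (hP (phi k).+1).
have phi_lt : {homo phi : i j / i < j}.
  exact: (homo_ltn ltn_trans phiS).
exists phi; split=> // i j; rewrite leq_eqVlt => /predU1P[->//|/phi_lt/ltnW le_phi] /=.
have min_phi : forall k, phi i <= k -> g (phi i) <= g k.
  by case: (i) => [|i']; [case: (hP 0) | case: (hP (phi i').+1)].
exact: min_phi.
Qed.

Lemma dickson n (f : nat -> Mon n) : exists i j, i < j /\ mdvd (f i) (f j).
Proof.
have [phi [phi_lt phiP]] : exists phi : nat -> nat, {homo phi : i j / i < j} /\
    forall k : 'I_n, {homo (fun i => tnth (f (phi i)) k) : i j / i <= j}.
  (* Make the first [d] coordinates monotone, and refine the subsequence once for each further
     coordinate. *)
  suff /(_ n)[phi [phi_lt phiP]] : forall d, exists phi : nat -> nat,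
      {homo phi : i j / i < j} /\ forall k : 'I_n, k < d ->
      {homo (fun i => tnth (f (phi i)) k) : i j / i <= j}.
    by exists phi; split=> // k; apply: phiP.
  elim=> [|d [phi [phi_lt phiP]]]; first by exists id; split=> [i j|[]].
  case: (ltnP d n) => [lt_dn|le_nd]; last first.
    by exists phi; split=> // k _; apply: phiP; apply: leq_trans le_nd.
  have [psi [psi_lt psiP]] :=
    nondecreasing_subseq (fun i => tnth (f (phi i)) (Ordinal lt_dn)).
  exists (phi \o psi); split=> [i j /psi_lt/phi_lt //|k].
  rewrite ltnS leq_eqVlt => /predU1P[kd|lt_kd] i j le_ij /=.
    by rewrite (_ : k = Ordinal lt_dn); [apply: psiP | apply: val_inj].
  apply: phiP => //; move: le_ij; rewrite leq_eqVlt => /predU1P[->//|].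
  by move/psi_lt/ltnW.
exists (phi 0), (phi 1); split; first exact: phi_lt.
by apply: mdvd_tnth => k; apply: phiP.
Qed.

Definition mdvd_by {n} (s : seq (Mon n)) (a : Mon n) : Prop :=
  exists2 b, b \in s & mdvd b a.

(** The longer list is the smaller one in this relation, so that well-foundedness forbids endless
    enlargement. *)
Definition extends {n} (s' s : seq (Mon n)) : Prop :=
  exists2 a, s' = a :: s & ~ mdvd_by s a.

(** From an inaccessible list, choice builds an infinite chain of extensions; the monomials added
    along it contradict [dickson]. *)
Lemma extends_wf n : well_founded (@extends n).
Proof.
move=> s; apply: NNPP => nAs.
pose X := {s : seq (Mon n) | ~ Acc extends s}.
have step (x : X) : exists y : X, extends (sval y) (sval x).
  case: x => t nAt /=; apply: NNPP => no; apply: nAt; constructor=> t' t't.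
  by apply: NNPP => nAt'; apply: no; exists (exist _ t' nAt').
have [next nextP] : exists next : X -> X, forall x, extends (sval (next x)) (sval x).
  exists (fun x => proj1_sig (constructive_indefinite_description _ (step x))).
  by move=> x; case: constructive_indefinite_description.
pose ch k := sval (iter k next (exist _ s nAs : X)).
have chS k : extends (ch k.+1) (ch k) by rewrite /ch iterS; apply: nextP.
(* [f k] is the monomial added at step [k]; since [ch k.+1] is never empty, the default is not
   reached. *)
pose f k := head (nseq_tuple n 0) (ch k.+1).
have f_mem i j : i < j -> f i \in ch j.
  elim: j => // j IH; rewrite ltnS leq_eqVlt => /predU1P[->|/IH fi_j];
    case: (chS j) => a eq_ch _; rewrite /f eq_ch ?mem_head //.
  by rewrite inE fi_j orbT.
have [i [j [lt_ij dvd_ij]]] := dickson f.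
case: (chS j) => a eq_ch nda; apply: nda; exists (f i); first exact: f_mem.
by move: dvd_ij; rewrite {2}/f eq_ch.
Qed.

(** * Spans and ideals of coefficient functions *)

Local Open Scope R_scope.

Section Spans.

Context {n : nat}.
Implicit Types (a b c m u v w : Mon n) (f g h p r : Mon n -> R).
Implicit Types B : (Mon n -> R) -> Prop.

(* The coefficient function of x^u f. *)
Definition shift u f m : R :=
  if mmul u (mdiv m u) == m then f (mdiv m u) else R0.

Lemma shift_mmul u f m : shift u f (mmul u m) = f m.
Proof. by rewrite /shift mmulK eqxx. Qed.

Lemma shift_supp u f m : shift u f m <> R0 -> exists2 k, m = mmul u k & f k <> R0.
Proof. by rewrite /shift; case: eqP => // mE fk; exists (mdiv m u). Qed.

Lemma shift_out u f m : (forall k, m <> mmul u k) -> shift u f m = R0.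
Proof. by move=> nu; rewrite /shift; case: eqP => // e; case: (nu (mdiv m u)). Qed.

Lemma shift_shift u v f m : shift u (shift v f) m = shift (mmul u v) f m.
Proof.
case: (classic (exists k, m = mmul u k)) => [[k ->]|nu]; last first.
  rewrite !shift_out // => k => [e|e]; apply: nu; last by exists k.
  by exists (mmul v k); rewrite mmulA.
rewrite shift_mmul.
case: (classic (exists l, k = mmul v l)) => [[l ->]|nv].
  by rewrite mmulA !shift_mmul.
rewrite !shift_out // => l e; apply: nv; exists l => //.
by apply: (@mmulI _ u); rewrite e mmulA.
Qed.

Lemma shift_linear u x f g m :
  shift u (fun k => x * f k + g k) m = (x * shift u f m + shift u g m).
Proof. by rewrite /shift; case: ifP => // _; ring. Qed.

Lemma eq_shift u f g m : (forall k, f k = g k) -> shift u f m = shift u g m.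
Proof. by rewrite /shift => ->. Qed.

(** Real linear combinations of elements of [B]. Equality is pointwise in both constructors, which
    avoids functional extensionality. *)
Inductive span B f : Prop :=
| Span0 of (forall m, f m = R0)
| SpanD x g h of B g & span B h & (forall m, f m = (x * g m + h m)).

Lemma span_eq B f g : span B f -> (forall m, g m = f m) -> span B g.
Proof.
case=> [f0|x p h Bp Sh fE] gE; first by apply: Span0 => m; rewrite gE.
by apply: (SpanD Bp Sh) => m; rewrite gE fE.
Qed.

Lemma span_lin B x f g h : span B f -> span B g ->
  (forall m, h m = (x * f m + g m)) -> span B h.
Proof.
move=> Sf Sg; elim: Sf h => {f} [f f0|f y p q Bp Sq IH fE] h hE.
  by apply: span_eq Sg _ => m; rewrite hE f0; ring.
apply: (SpanD (x := (x * y)) Bp (IH _ (fun m => erefl))) => m.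
by rewrite hE fE; ring.
Qed.

Lemma span_gen B f : B f -> span B f.
Proof.
move=> Bf; apply: (SpanD (x := R1) (h := fun=> R0) Bf); first exact: Span0.
by move=> m; ring.
Qed.

Lemma span_bind B B' f : (forall g, B g -> span B' g) -> span B f -> span B' f.
Proof.
move=> BB'; elim=> {f} [f f0|f x g h Bg _ IH fE]; first exact: Span0.
exact: (span_lin (x := x) (BB' _ Bg) IH).
Qed.

(** Polynomials are combinations of monomials, so the monomial multiples of [B] already span the
    generated ideal. *)
Definition ideal B := span (fun f => exists u g, B g /\ f = shift u g).

Lemma ideal_gen B u g : B g -> ideal B (shift u g).
Proof. by move=> Bg; apply: span_gen; exists u, g. Qed.

Lemma span_shift B B' w f : (forall g, B g -> span B' (shift w g)) ->
  span B f -> span B' (shift w f).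
Proof.
move=> BB'; elim=> {f} [f f0|f x g h Bg _ IH fE].
  by apply: Span0 => m; rewrite /shift f0; case: ifP.
apply: (span_lin (x := x) (BB' _ Bg) IH) => m.
by rewrite (eq_shift _ _ fE) shift_linear.
Qed.

Lemma ideal_shift B w f : ideal B f -> ideal B (shift w f).
Proof.
apply: span_shift => _ [u [g [Bg ->]]].
by apply: span_eq (ideal_gen (mmul w u) Bg) _ => m; rewrite shift_shift.
Qed.

Lemma ideal_bind B B' f : (forall g, B g -> ideal B' g) -> ideal B f -> ideal B' f.
Proof.
by move=> BB'; apply: span_bind => _ [u [g [/BB' Bg ->]]]; apply: ideal_shift.
Qed.

End Spans.

(** * List polynomials and the ideals they generate *)

Lemma coef_cat n (p q : rpoly n) m : coef (p ++ q) m = coef p m + coef q m.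
Proof. by elim: p => [|t p IH] /=; [ring | rewrite -!/(coef _ m) IH; ring]. Qed.

Lemma coef_shift n x (u : Mon n) (q : rpoly n) m :
  coef [seq (x * t.1, mmul u t.2) | t <- q] m = x * shift u (coef q) m.
Proof.
elim: q => [|t q IH] /=; first by rewrite /shift; case: ifP => _ /=; ring.
rewrite -!/(coef _ _) IH.
have -> : (if mmul u t.2 == m then x * t.1 else R0) =
    x * shift u (fun k => if t.2 == k then t.1 else R0) m.
  case: eqP => [<-|ne]; first by rewrite shift_mmul eqxx.
  have -> : shift u (fun k => if t.2 == k then t.1 else R0) m = R0; last by ring.
  by apply: NNPP => /shift_supp[k mE]; case: eqP => // tk _; apply: ne; rewrite mE tk.
by rewrite /shift; case: ifP => _ /=; ring.
Qed.

Lemma coef_pmul_cons n t (h g : rpoly n) m :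
  coef (pmul (t :: h) g) m = t.1 * shift t.2 (coef g) m + coef (pmul h g) m.
Proof. by rewrite /pmul /= coef_cat coef_shift. Qed.

Definition coefs n (ps : seq (rpoly n)) (f : Mon n -> R) : Prop :=
  exists2 p, List.In p ps & f = coef p.

Lemma coefs_cons n (p : rpoly n) ps f : coefs ps f -> coefs (p :: ps) f.
Proof. by case=> q qps fE; exists q; [right|]. Qed.

Lemma ideal_self n (B : (Mon n -> R) -> Prop) f : B f -> ideal B f.
Proof.
move=> /(ideal_gen (nseq_tuple n 0%N)) If; apply: span_eq If _ => m.
rewrite -{2}(_ : mmul (nseq_tuple n 0%N) m = m) ?shift_mmul //.
by apply: eq_from_tnth => i; rewrite tnth_mktuple tnth_nseq.
Qed.

Definition combination n (hs gs : seq (rpoly n)) : rpoly n :=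
  flatten [seq pmul hg.1 hg.2 | hg <- zip hs gs].

Lemma combination_cons n (h g : rpoly n) hs gs :
  combination (h :: hs) (g :: gs) = pmul h g ++ combination hs gs.
Proof. by []. Qed.

Lemma ideal_combination n (hs ps : seq (rpoly n)) :
  ideal (coefs ps) (coef (combination hs ps)).
Proof.
elim: ps hs => [|p ps IH] [|h hs] /=; try exact: Span0.
have I1 : ideal (coefs (p :: ps)) (coef (pmul h p)).
  elim: h => [|t h IHh]; first exact: Span0.
  apply: (span_lin (x := t.1) _ IHh (coef_pmul_cons t h p)).
  by apply: ideal_gen; exists p; [left|].
have I2 : ideal (coefs (p :: ps)) (coef (combination hs ps)).
  by apply: ideal_bind (IH hs) => g Bg; apply: ideal_self; apply: coefs_cons.
apply: (span_lin (x := 1) I1 I2) => m.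
by rewrite combination_cons coef_cat; ring.
Qed.

Lemma ideal_coefsP n (ps : seq (rpoly n)) f : ideal (coefs ps) f ->
  exists2 q, in_gen_ideal ps q & forall m, coef q m = f m.
Proof.
suff comb : ideal (coefs ps) f -> exists2 hs, size hs = size ps & forall m,
    coef (combination hs ps) m = f m.
  by case/comb=> hs sz fE; exists (combination hs ps) => //; exists hs.
elim=> {f} [f f0|f x _ h [u [_ [[p pps ->] ->]]] _ [hs sz hE] fE].
  exists (nseq (size ps) [::]) => [|m]; first by rewrite size_nseq.
  by rewrite f0; elim: ps.
suff [hs' sz' hE'] : exists2 hs', size hs' = size ps & forall m,
    coef (combination hs' ps) m =
    x * shift u (coef p) m +
    coef (combination hs ps) m.
  by exists hs' => // m; rewrite hE' hE fE.
(* The new multiple is absorbed by adding the term [(x, u)] to the cofactor of [p]. *)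
elim: ps hs sz {hE} pps => // q ps IH [//|h0 hs] /= [sz] [<-|/(IH hs sz)].
  exists (((x, u) :: h0) :: hs) => [|m]; first by rewrite /= sz.
  by rewrite !combination_cons coef_cat coef_pmul_cons coef_cat /=; ring.
case=> hs' sz' E; exists (h0 :: hs') => [|m]; first by rewrite /= sz'.
by rewrite !combination_cons !coef_cat E; ring.
Qed.

(** * Finite supports and leading monomials *)

Section Order.

Context {n : nat} {lt : Mon n -> Mon n -> Prop} (Hlt : monomial_order lt).
Implicit Types (a b c m u v w : Mon n) (f g h p r : Mon n -> R).
Implicit Types (s T : seq (Mon n)).

Definition le a b : Prop := a = b \/ lt a b.

Lemma lt_le_trans a b c : lt a b -> le b c -> lt a c.
Proof. by move=> ab [<-//|]; apply: mo_trans ab. Qed.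

Lemma le_trans a b c : le a b -> le b c -> le a c.
Proof. by case=> [->//|ab /(lt_le_trans ab)]; right. Qed.

Lemma le_total a b : le a b \/ le b a.
Proof. by case: (mo_total Hlt a b) => [->|[]]; rewrite /le; auto. Qed.

Lemma lt_mmul u a b : lt a b -> lt (mmul u a) (mmul u b).
Proof. by move=> ab; rewrite ![mmul u _]mmulC; apply: mo_mul. Qed.

Lemma le_mmul u a b : le a b -> le (mmul u a) (mmul u b).
Proof. by case=> [->|/(lt_mmul u)]; [left | right]. Qed.

Lemma seq_max (P : Mon n -> Prop) T : (forall k, k \in T -> ~ P k) \/
  exists m, [/\ m \in T, P m & forall k, k \in T -> P k -> le k m].
Proof.
elim: T => [|a T IH]; first by left.
case: (classic (P a)) => [Pa|nPa]; last first.
  case: IH => [no|[m [mT Pm max_m]]]; [left|right] => [k|].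
    by rewrite inE => /predU1P[->|/no].
  exists m; split=> // [|k]; first by rewrite inE mT orbT.
  by rewrite inE => /predU1P[-> //|/max_m].
right; case: IH => [no|[m [mT Pm max_m]]].
  exists a; split=> // [|k]; first by rewrite mem_head.
  by rewrite inE => /predU1P[-> _|/no]; [left|].
case: (le_total a m) => [am|ma].
  exists m; split=> // [|k]; first by rewrite inE mT orbT.
  by rewrite inE => /predU1P[->|/max_m].
exists a; split=> // [|k]; first by rewrite mem_head.
by rewrite inE => /predU1P[-> _|kT Pk]; [left | exact: le_trans (max_m _ kT Pk) ma].
Qed.

Definition supp_in T f : Prop := forall m, f m <> R0 -> m \in T.

Definition lead f a : Prop := f a <> R0 /\ forall b, f b <> R0 -> le b a.

Lemma lead_uniq f a b : lead f a -> lead f b -> a = b.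
Proof.
move=> [fa la] [fb lb]; case: (la _ fb) (lb _ fa) => [->//|ba] [//|ab].
by case: (mo_irrefl Hlt (mo_trans Hlt ab ba)).
Qed.

Lemma supp_in_lead T f : supp_in T f ->
  (forall m, f m = R0) \/ exists2 a, a \in T & lead f a.
Proof.
move=> fT; case: (seq_max (fun k => f k <> R0) T) => [no|[a [aT fa max_a]]].
  by left=> m; apply: NNPP => fm; apply: (no m) => //; apply: fT.
by right; exists a => //; split=> // b fb; apply: max_a => //; apply: fT.
Qed.

Lemma shift_supp_in u T f : supp_in T f -> supp_in [seq mmul u k | k <- T] (shift u f).
Proof. by move=> fT m /shift_supp[k -> /fT kT]; apply: map_f. Qed.

Lemma shift_lead u f a : lead f a -> lead (shift u f) (mmul u a).
Proof.
case=> fa la; split=> [|b /shift_supp[k -> /la]]; first by rewrite shift_mmul.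
exact: le_mmul.
Qed.

(** * Buchberger's criterion *)

(* [G a g] says that [g] is a generator with leading monomial [a]; [std G P]
   consists of the combinations of multiples of generators whose leading
   monomials satisfy [P]. *)
Definition std (G : Mon n -> (Mon n -> R) -> Prop) (P : Mon n -> Prop) :=
  span (fun f => exists a g u, [/\ G a g, P (mmul u a) & f = shift u g]).

Implicit Types G : Mon n -> (Mon n -> R) -> Prop.

Lemma std_sub G (P Q : Mon n -> Prop) f :
  (forall m, P m -> Q m) -> std G P f -> std G Q f.
Proof.
move=> PQ; apply: span_bind => _ [a [g [u [Gag Pua ->]]]].
by apply: span_gen; exists a, g, u; split=> //; apply: PQ.
Qed.

Lemma std_shift G (P Q : Mon n -> Prop) w f :
  (forall m, P m -> Q (mmul w m)) -> std G P f -> std G Q (shift w f).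
Proof.
move=> PQ; apply: span_shift => _ [a [g [u [Gag Pua ->]]]].
apply: (@span_eq _ _ (shift (mmul w u) g)) => [|m]; last by rewrite shift_shift.
by apply: span_gen; exists a, g, (mmul w u); split=> //; rewrite -mmulA; apply: PQ.
Qed.

Lemma std_add G P a g u x h f : G a g -> P (mmul u a) -> std G P h ->
  (forall k, f k = x * shift u g k + h k) -> std G P f.
Proof. by move=> Gag Pua; apply: SpanD; exists a, g, u. Qed.

Definition gens G g : Prop := exists a, G a g.

Lemma std_ideal G P f : std G P f -> ideal (gens G) f.
Proof.
apply: span_bind => _ [a [g [u [Gag _ ->]]]]; apply: ideal_gen; by exists a.
Qed.

Lemma ideal_std G f : ideal (gens G) f -> std G (fun=> True) f.
Proof.
by apply: span_bind => _ [u [g [[a Gag] ->]]]; apply: span_gen; exists a, g, u.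
Qed.

(** A combination has finitely many terms; the largest of their leading monomials serves as [m]. *)
Lemma std_bound G P f : std G P f ->
  (forall m, f m = R0) \/ exists2 m, P m & std G (le^~ m) f.
Proof.
elim=> {f} [f f0|f x _ h [a [g [u [Gag Pua ->]]]] _ IH fE]; first by left.
right; case: IH => [h0|[m Pm Sh]].
  exists (mmul u a) => //; apply: (std_add Gag _ _ fE); first by left.
  exact: Span0.
case: (le_total (mmul u a) m) => [um|mu]; [exists m | exists (mmul u a)] => //.
  exact: std_add Gag um Sh fE.
apply: (std_add Gag _ _ fE); first by left.
by apply: (std_sub _ Sh) => k km; apply: le_trans mu.
Qed.

Definition leads G := forall a g, G a g -> lead g a.

Lemma std_le_supp G m f b : leads G -> std G (le^~ m) f -> f b <> R0 -> le b m.
Proof.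
move=> lG; elim=> {f} [f f0|f x _ h [a [g [u [Gag um ->]]]] _ IH fE] fb.
  by case: (fb (f0 b)).
case: (classic (shift u g b = R0)) => [g0|]; last first.
  by case: (shift_lead u (lG _ _ Gag)) => _ lu /lu/le_trans; apply.
by apply: IH => h0; apply: fb; rewrite fE g0 h0; ring.
Qed.

Lemma std_lt_top G m f : leads G -> std G (lt^~ m) f -> f m = R0.
Proof.
move=> lG Sf; apply: NNPP => fm; case: (std_bound Sf) => [//|[k km Sk]].
by case: (mo_irrefl Hlt (lt_le_trans km (std_le_supp lG Sk fm))).
Qed.

(** The function is the S-polynomial, cross-multiplied by leading coefficients to avoid division.
    All common multiples of [a] and [b] are allowed, not just the least one. *)
Definition s_pairs_reduce G := forall a g b h u v, G a g -> G b h ->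
  mmul u a = mmul v b -> std G (lt^~ (mmul u a))
    (fun k => h b * shift u g k - g a * shift v h k).

(** Terms with leading monomial exactly [m] are merged one by one: an S-pair trades a multiple of
    one generator for a multiple of another, up to terms below [m]. *)
Lemma std_le_top G m f : leads G -> s_pairs_reduce G -> std G (le^~ m) f ->
  std G (lt^~ m) f \/ exists a g u x, [/\ G a g, mmul u a = m &
    std G (lt^~ m) (fun k => f k - x * shift u g k)].
Proof.
move=> lG red; elim=> {f} [f f0|f x _ h [a [g [u [Gag um ->]]]] _ IH fE].
  by left; apply: Span0.
case: um => [um|um]; case: IH => [Sh|[b [p [v [y [Gbp vm Sh]]]]]].
- right; exists a, g, u, x; split=> //; apply: span_eq Sh _ => k.
  by rewrite fE; ring.
- have [pb _] := lG _ _ Gbp.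
  (* The S-pair scaled by [x / p b] turns [x * shift u g] into [x * (g a / p b) * shift v p] plus
     lower terms. *)
  right; exists b, p, v, (y + x * (g a / p b)); split=> //.
  have := red _ _ _ _ u v Gag Gbp (etrans um (esym vm)); rewrite um => Sr.
  by apply: (span_lin (x := x / p b) Sr Sh) => k; rewrite fE; field.
- by left; apply: std_add Gag um Sh fE.
right; exists b, p, v, y; split=> //.
by apply: (std_add (x := x) Gag um Sh) => k; rewrite fE; ring.
Qed.

(** At most one top term remains after merging; comparing coefficients at [m] forces its scalar to
    be zero. *)
Lemma std_cancel G m f : leads G -> s_pairs_reduce G -> std G (le^~ m) f ->
  f m = R0 -> std G (lt^~ m) f.
Proof.
move=> lG red Sf fm.
case: (std_le_top lG red Sf) => [//|[a [g [u [x [Gag um Sx]]]]]].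
have := std_lt_top lG Sx; rewrite fm -{1}um shift_mmul => xg.
have [ga _] := lG _ _ Gag.
have x0 : x = R0 by apply: (Rmult_eq_reg_r (g a)) => //; lra.
by apply: span_eq Sx _ => k; rewrite x0; ring.
Qed.

(** Well-founded induction on the bound [m] of a representation of [f]. If [f m] is zero the bound
    drops; otherwise [m] is the leading monomial of [f], and it comes from the single top term of
    [std_le_top]. *)
Lemma buchberger G f c : leads G -> s_pairs_reduce G -> ideal (gens G) f ->
  lead f c -> exists a g, G a g /\ mdvd a c.
Proof.
move=> lG red /ideal_std/std_bound[f0 [fc _]|[m _]]; first by case: (fc (f0 c)).
elim/(well_founded_induction (mo_wf Hlt)): m => m IH Sf fc.
case: (classic (f m = R0)) => [fm|fm].
  case: (std_bound (std_cancel lG red Sf fm)) => [f0|[k km Sk]].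
    by case: fc => fc _; case: (fc (f0 c)).
  exact: IH km Sk fc.
have -> : c = m.
  by apply: lead_uniq fc _; split=> // b; apply: std_le_supp lG Sf.
case: (std_le_top lG red Sf) => [/(std_lt_top lG)//|[a [g [u [x [Gag um _]]]]]].
by exists a, g; split=> //; exists u.
Qed.

(** * Reduction with uniformly bounded supports *)

(** The finite data [s] and [T] are all that the bounds below may depend on; [G] itself varies, and
    several generators may share a leading monomial. *)
Definition shape s T G : Prop :=
  (forall a, a \in s -> exists g, G a g) /\
  (forall a g, G a g -> [/\ a \in s, lead g a & supp_in T g]).

Lemma shape_leads s T G : shape s T G -> leads G.
Proof. by case=> _ sG a g /sG[]. Qed.

(** The point is that [T'] precedes [G] and [f]. Division is followed on supports alone, by
    induction on [m], and stops once the leading monomial is irreducible by [s]. *)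
Lemma reduction_bound m s T T1 : exists T', forall G f, shape s T G ->
  supp_in T1 f -> (forall k, f k <> R0 -> lt k m) ->
  exists r, [/\ supp_in T' r, std G (lt^~ m) (fun k => f k - r k) &
    forall c, lead r c -> ~ mdvd_by s c].
Proof.
elim/(well_founded_induction (mo_wf Hlt)): m T1 => m IH T1.
(* [m'] is the largest possible leading monomial, computed from [T1] and [m] without looking at
   [f]. *)
case: (seq_max (lt^~ m) T1) => [no|[m' [m'T m'm max_m']]].
  exists [::] => G f _ fT fm.
  have f0 k : f k = R0 by apply: NNPP => fk; apply: (no k); [exact: fT | exact: fm].
  exists (fun=> R0); split=> // [|c []//]; apply: Span0 => k; rewrite f0; ring.
case: (classic (mdvd_by s m')) => [[a a_s [u m'E]]|ndvd].
  have [T' T'P] := IH m' m'm (T1 ++ [seq mmul u k | k <- T]).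
  exists T' => G f sG fT fm.
  have [[/(_ a a_s)[g Gag] sG2]] := (sG, sG).
  have [_ lga gT] := sG2 _ _ Gag; have [ga _] := lga.
  have fm' k : f k <> R0 -> le k m' by move=> fk; apply: max_m'; auto.
  have [| |r [rT' Sr rlead]] :=
    T'P G (fun k => f k - (f m' / g a) * shift u g k) sG.
  - move=> k; rewrite mem_cat => fk; case: (classic (f k = R0)) => [f0|/fT->//].
    rewrite (shift_supp_in gT) ?orbT // => g0; apply: fk; rewrite f0 g0; ring.
  - move=> k fk; suff [kE|//] : le k m'.
      by case: fk; rewrite kE m'E shift_mmul; field.
    case: (classic (f k = R0)) => [f0|/fm'//]; rewrite m'E.
    case: (shift_lead u lga) => _; apply => g0; apply: fk; rewrite f0 g0; ring.
  exists r; split=> //.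
  have um : lt (mmul u a) m by rewrite -m'E.
  have {}Sr := std_sub (fun k km' => mo_trans Hlt km' m'm) Sr.
  by apply: (std_add (P := lt^~ m) (x := f m' / g a) Gag um Sr) => k; ring.
(* Here [m'] is irreducible. Either it occurs in [f], which is then its own remainder, or the
   reduction continues below [m']; [T1 ++ T'] covers both outcomes. *)
have [T' T'P] := IH m' m'm T1.
exists (T1 ++ T') => G f sG fT fm.
have fm' k : f k <> R0 -> le k m' by move=> fk; apply: max_m'; auto.
case: (classic (f m' = R0)) => [f0|fn0].
  have [k fk|r [rT' Sr rlead]] := T'P G f sG fT.
    by case: (fm' k fk) => // kE; case: fk; rewrite kE.
  exists r; split=> // [k /rT' kT'|]; first by rewrite mem_cat kT' orbT.
  by apply: (std_sub _ Sr) => k km'; apply: mo_trans m'm.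
exists f; split=> [k /fT kT||c fc]; first by rewrite mem_cat kT.
  by apply: Span0 => k; ring.
by rewrite (lead_uniq fc (conj fn0 fm')).
Qed.

(** Concatenating the witnesses gives one that works uniformly, by monotonicity. *)
Lemma seq_choice (X Y : eqType) (P : X -> seq Y -> Prop) (l : seq X) :
  (forall x t t', {subset t <= t'} -> P x t -> P x t') ->
  (forall x, x \in l -> exists t, P x t) -> exists t, forall x, x \in l -> P x t.
Proof.
move=> mono; elim: l => [|x l IH] ex; first by exists [::].
have [t tP] := ex x (mem_head x l).
have [|t' t'P] := IH; first by move=> y yl; apply: ex; rewrite inE yl orbT.
exists (t ++ t') => y; rewrite inE => /predU1P[->|/t'P].
  by apply: mono tP => z zt; rewrite mem_cat zt.
by apply: mono => z zt; rewrite mem_cat zt orbT.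
Qed.

(** There are finitely many pairs of leading monomials in [s]; reduce the S-polynomials at their
    least common multiples and collect the resulting bounds. A nonzero remainder gives the second
    alternative. *)
Lemma s_pair_bound s T : exists T', forall G, shape s T G ->
  s_pairs_reduce G \/ exists c r, [/\ c \in T', ~ mdvd_by s c, lead r c,
    supp_in T' r & ideal (gens G) r].
Proof.
pose good (ab : Mon n * Mon n) T' := forall G g h, shape s T G ->
  G ab.1 g -> G ab.2 h -> (forall u v, mmul u ab.1 = mmul v ab.2 ->
    std G (lt^~ (mmul u ab.1))
      (fun k => h ab.2 * shift u g k - g ab.1 * shift v h k)) \/
  exists c r, [/\ c \in T', ~ mdvd_by s c, lead r c,
    supp_in T' r & ideal (gens G) r].
have [[a b] t t' tt' gt|[a b] _|T' T'P] :=
    @seq_choice _ _ good [seq (a, b) | a <- s, b <- s].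
- move=> G g h sG Ga Gb; case: (gt G g h sG Ga Gb) => [|[c [r [ct nd lr rt Ir]]]].
    by left.
  right; exists c, r; split=> //; first exact: tt'.
  by move=> k /rt/tt'.
- have [m [u [v [mu mv mlcm]]]] := mdvd_lcm a b.
  have [T' T'P] := reduction_bound m s T
    ([seq mmul u k | k <- T] ++ [seq mmul v k | k <- T]).
  exists T' => G g h sG /= Ga Gb; have [_ sG2] := sG.
  have [_ la gT] := sG2 _ _ Ga; have [_ lb hT] := sG2 _ _ Gb.
  pose S k := h b * shift u g k - g a * shift v h k.
  have S_supp k : S k <> R0 -> shift u g k <> R0 \/ shift v h k <> R0.
    move=> Sk; apply: NNPP => /not_or_and[/NNPP g0 /NNPP h0].
    by apply: Sk; rewrite /S g0 h0; ring.
  have [| |r [rT' Sr nd]] := T'P G S sG.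
  + move=> k; rewrite mem_cat => /S_supp[/(shift_supp_in gT)->//|].
    by move/(shift_supp_in hT)->; rewrite orbT.
  + move=> k Sk; suff [kE|//] : le k m.
      by case: Sk; rewrite kE /S {1}mu mv !shift_mmul; ring.
    case: (S_supp k Sk).
      by rewrite mu; case: (shift_lead u la) => _; apply.
    by rewrite mv; case: (shift_lead v lb) => _; apply.
  case: (supp_in_lead rT') => [r0|[c cT' rc]]; last first.
    right; exists c, r; split=> //; first exact: nd.
    have IS : ideal (gens G) S.
      apply: (@span_lin _ _ (h b) (shift u g) (fun k => - g a * shift v h k)).
      - by apply: ideal_gen; exists a.
      - apply: (@span_lin _ _ (- g a) (shift v h) (fun=> R0)).
        + by apply: ideal_gen; exists b.
        + exact: Span0.
        + by move=> k; ring.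
      by move=> k; rewrite /S; ring.
    by apply: (span_lin (x := - 1) (std_ideal Sr) IS) => k; rewrite /S; ring.
  left=> u' v' e.
  (* Any other common multiple is [mmul w m], so the reduction at the least one is multiplied by the
     monomial [w]. *)
  have [w wE] : mdvd m (mmul u' a) by apply: mlcm; [exists u' | rewrite e; exists v'].
  have u'E : u' = mmul w u.
    by apply: (@mmulI _ a); rewrite mmulC wE mu mmulA mmulC.
  have v'E : v' = mmul w v.
    by apply: (@mmulI _ b); rewrite mmulC -e wE mv mmulA mmulC.
  have Sw : std G (lt^~ (mmul w m)) (shift w (fun k => S k - r k)).
    by apply: std_shift Sr => k; apply: lt_mmul.
  rewrite wE; apply: span_eq Sw _ => k.
  rewrite u'E v'E -!shift_shift /S /shift; case: ifP => _; rewrite ?r0; ring.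
exists T' => G sG; apply: NNPP => /not_or_and[nred nr]; apply: nred.
move=> a g b h u v Ga Gb e.
have [_ sG2] := sG.
have [a_s _ _] := sG2 _ _ Ga; have [b_s _ _] := sG2 _ _ Gb.
by case: (T'P (a, b) (allpairs_f _ a_s b_s) G g h sG Ga Gb) => [|/nr//]; apply.
Qed.

(** * Finiteness *)

Definition lead_monomials_are (B : (Mon n -> R) -> Prop) s : Prop :=
  forall a, (exists2 f, ideal B f & lead f a) <-> mdvd_by s a.

(** Induction along [extends]: either Buchberger's criterion applies and [s] is the answer, or a
    remainder with leading monomial in [T'] is adjoined. *)
Lemma shape_finite s T : exists L : seq (seq (Mon n)), forall G, shape s T G ->
  exists2 t, t \in L & lead_monomials_are (gens G) t.
Proof.
elim/(well_founded_induction (@extends_wf n)): s T => s IH T.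
have [T' T'P] := s_pair_bound s T.
(* The first disjunct disposes of candidates in [T'] divisible by [s], for which there is no
   induction hypothesis. *)
pose good c (L : seq (seq (Mon n))) := forall G,
  mdvd_by s c \/ (shape (c :: s) (T ++ T') G ->
  exists2 t, t \in L & lead_monomials_are (gens G) t).
have [c L L' LL' gL G|c _|L LP] := @seq_choice _ _ good T'.
- case: (gL G) => [|sG]; [by left | right=> /sG[t tL tG]].
  by exists t => //; apply: LL'.
- case: (classic (mdvd_by s c)) => [dc|ndc]; first by exists [::] => G; left.
  have [|L LP] := IH (c :: s) _ (T ++ T'); first by exists c.
  by exists L => G; right; apply: LP.
exists (s :: L) => G sG; have [sG1 sG2] := sG; have lG := shape_leads sG.
case: (T'P G sG) => [red|[c [r [cT' ndc rc rT' Ir]]]].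
  exists s; first exact: mem_head.
  move=> a; split=> [[f If fa]|[b bs [u ->]]].
    have [b [g [Gb ba]]] := buchberger lG red If fa.
    by have [bs _ _] := sG2 _ _ Gb; exists b.
  have [g Gb] := sG1 b bs; exists (shift u g); last exact: shift_lead (lG _ _ Gb).
  by apply: ideal_gen; exists b.
(* Since [r] lies in the ideal of [G], adjoining it leaves the ideal unchanged. *)
pose G' a g := G a g \/ a = c /\ g = r.
have sG' : shape (c :: s) (T ++ T') G'.
  split=> [a|a g [/sG2[a_s la gT]|[-> ->]]].
  - rewrite inE => /predU1P[->|/sG1[g Ga]]; first by exists r; right.
    by exists g; left.
  - by split=> // [|k /gT kT]; rewrite ?inE ?mem_cat ?a_s ?kT ?orbT.
  by split=> // [|k /rT' kT]; rewrite ?mem_head // mem_cat kT orbT.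
case: (LP c cT' G') => [//|/(_ sG')[t tL tG']].
exists t => [|a]; first by rewrite inE tL orbT.
rewrite -(tG' a); split=> [] [f If fa]; exists f => //.
  apply: ideal_bind If => g [b Gb]; apply: ideal_self; exists b; by left.
apply: ideal_bind If => g [b [Gb|[_ ->]] //].
by apply: ideal_self; exists b.
Qed.

Lemma sub_seqs (X : eqType) (l : seq X) : exists L : seq (seq X),
  forall P : X -> Prop, exists2 t, t \in L & forall x, x \in t <-> x \in l /\ P x.
Proof.
elim: l => [|x l [L LP]].
  by exists [:: [::]] => P; exists [::] => // y; split=> // [[]].
exists (L ++ [seq x :: t | t <- L]) => P; have [t tL tP] := LP P.
case: (classic (P x)) => [Px|nPx]; [exists (x :: t) | exists t].
- by rewrite mem_cat map_f ?orbT.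
- move=> y; rewrite !inE; split=> [/predU1P[->|/tP[yl Py]]|[/predU1P[->|yl] Py]].
  + by rewrite eqxx.
  + by rewrite yl orbT.
  + by rewrite eqxx.
  + by rewrite (proj2 (tP y) (conj yl Py)) orbT.
- by rewrite mem_cat tL.
move=> y; rewrite inE; split=> [/tP[yl Py]|[/predU1P[->//|yl] Py]].
  by rewrite yl orbT.
exact/tP.
Qed.

(** The leading monomials of the generators form one of the finitely many subsets of [T];
    [shape_finite] is applied to each. *)
Lemma bounded_support_finite T : exists L : seq (seq (Mon n)),
  forall B : (Mon n -> R) -> Prop, (forall g, B g -> supp_in T g) ->
  exists2 t, t \in L & lead_monomials_are B t.
Proof.
have [Ls LsP] := sub_seqs T.
have [s L L' LL' PL G|s _|L LP] :=
    @seq_choice _ _ (fun s (L : seq (seq (Mon n))) => forall G,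
    shape s T G -> exists2 t, t \in L & lead_monomials_are (gens G) t) Ls.
- by case/PL=> t /LL'; exists t.
- exact: shape_finite.
(* [G] keeps exactly the nonzero elements of [B], and so generates the same ideal. *)
exists L => B BT; pose G a g := B g /\ lead g a.
have [s sLs sP] := LsP (fun a => exists g, G a g).
have sG : shape s T G.
  split=> [a /sP[]//|a g Gag]; have [Bg ga] := Gag; split=> //; last exact: BT.
  by apply/sP; split; [apply: BT Bg _ ga.1 | exists g].
have [t tL tG] := LP s sLs G sG; exists t => // a; rewrite -(tG a).
split=> [] [f If fa]; exists f => //; apply: ideal_bind If => g.
  move=> Bg; case: (supp_in_lead (BT g Bg)) => [g0|[b _ gb]]; first exact: Span0.
  by apply: ideal_self; exists b.
by case=> b [Bg _]; apply: ideal_self.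
Qed.

End Order.

(** * Supports in interval families, and the conclusion *)

Lemma coef_supp_in n (p : rpoly n) : supp_in (unzip2 p) (coef p).
Proof.
move=> m; elim: p => //= t p IH; rewrite -/(coef p m) inE.
case: eqVneq => //= _; rewrite Rplus_0_l; exact: IH.
Qed.

Lemma in_family_supp n (f : ipoly n) p :
  in_family f p -> supp_in (unzip2 f) (coef p).
Proof.
case=> cs [cf pE] m; rewrite pE => /coef_supp_in.
elim: cf => //= c t cs' f' _ _ IH; rewrite !inE => /orP[->//|/IH ->].
by rewrite orbT.
Qed.

Lemma in_system_family_supp n (S : seq (ipoly n)) ps : in_system_family S ps ->
  forall g, coefs ps g -> supp_in (unzip2 (flatten S)) g.
Proof.
move=> Sps g [p pps ->] m; elim: Sps pps => // f q S' ps' fq _ IH /=.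
rewrite /unzip2 map_cat mem_cat => -[<-|/IH{}IH /IH ->]; last by rewrite orbT.
by move/(in_family_supp fq) => ->.
Qed.

(* The set { in(I) : I in IF([S]) } is finite: there is a finite list of
   ideals (as sets of polynomials) such that every initial ideal in(I),
   I = <p_1,...,p_l> with (p_1,...,p_l) in F([S]), equals one of them. *)
Theorem theorem6p3 (n : nat) (S : seq (ipoly n))
    (lt : Mon n -> Mon n -> Prop) (Hlt : monomial_order lt) :
  exists L : seq (rpoly n -> Prop),
    forall ps : seq (rpoly n), in_system_family S ps ->
      exists J, List.In J L /\
        forall q, initial_ideal lt (in_gen_ideal ps) q <-> J q.
Proof.
have [L LP] := bounded_support_finite Hlt (unzip2 (flatten S)).
(* [J t] is the monomial ideal generated by [t], phrased like [initial_ideal] so that only the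
   condition on [gs] has to be compared. *)
pose J t (q : rpoly n) := exists gs : seq (Mon n),
  (forall a, List.In a gs -> mdvd_by t a) /\ in_gen_ideal [seq mono a | a <- gs] q.
exists [seq J t | t <- L] => ps Sps.
have [t tL tP] := LP _ (in_system_family_supp Sps).
exists (J t); split.
  elim: L tL {LP} => //= s L IH; rewrite inE => /predU1P[->|/IH]; by [left|right].
have leadE a : (exists f, in_gen_ideal ps f /\ leading_mon lt f a) <-> mdvd_by t a.
  rewrite -(tP a); split=> [[f [[hs [_ fE]] fa]]|[f If [fa la]]].
    exists (coef f) => //; exact: span_eq (ideal_combination hs ps) fE.
  have [q Iq qE] := ideal_coefsP If; exists q; split=> //.
  by split=> [|b]; rewrite qE //; apply: la.
by move=> q; split=> -[gs [gsP qgs]]; exists gs; split=> // a /gsP/leadE.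
Qed.
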